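(* Let $(V,\circ)$ be a Novikov algebra over $\mathbb{C}$, let $k\in\mathbb{C}$, and define $[a,b]^-_k=k(a\circ b-b\circ a)$ for $a,b\in V$, so that $(V,\circ,[\cdot,\cdot]^-_k)$ is a Gel'fand-Dorfman bialgebra. If the quadratic Lie conformal algebra $R=\mathbb{C}[\partial]V$ corresponding to $(V,\circ,[\cdot,\cdot]^-_k)$ is simple, then $(V,\circ)$ is a simple Novikov algebra. In particular (the case $k=0$), if the Lie conformal algebra $R=\mathbb{C}[\partial]V$ corresponding to the Novikov algebra $(V,\circ)$ (with trivial Lie bracket) is simple, then $(V,\circ)$ is simple.
   Context: All vector spaces are over $\mathbb{C}$. A Lie conformal algebra is a $\mathbb{C}[\partial]$-module $R$ with a $\mathbb{C}$-bilinear $\lambda$-bracket $[\cdot_\lambda\cdot]:R\times R\to R[\lambda]=R\otimes\mathbb{C}[\lambda]$ such that for all $a,b,c\in R$: $[\partial a_\lambda b]=-\lambda[a_\lambda b]$ and $[a_\lambda\partial b]=(\lambda+\partial)[a_\lambda b]$; $[a_\lambda b]=-[b_{-\lambda-\partial}a]$; $[a_\lambda[b_\mu c]]=[[a_\lambda b]_{\lambda+\mu}c]+[b_\mu[a_\lambda c]]$. For subspaces $A,B\subset R$, $[A,B]$ is the $\mathbb{C}$-linear span of all coefficients (in powers of $\lambda$) of $[a_\lambda b]$, $a\in A$, $b\in B$. An ideal of $R$ is a $\mathbb{C}[\partial]$-submodule $I\subset R$ with $[R,I]\subset I$. $R$ is abelian if $[R,R]=0$, and simple if it is not abelian and its only ideals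 are $0$ and $R$. A Novikov algebra is a vector space $V$ with a bilinear product $\circ$ satisfying $(a\circ b)\circ c-a\circ(b\circ c)=(b\circ a)\circ c-b\circ(a\circ c)$ and $(a\circ b)\circ c=(a\circ c)\circ b$. An ideal of $(V,\circ)$ is a subspace $I$ with $V\circ I\subset I$ and $I\circ V\subset I$. $(V,\circ)$ is simple if its only ideals are $0$ and $V$ and $a\circ b\neq 0$ for some $a,b\in V$. A Gel'fand-Dorfman bialgebra $(V,\circ,[\cdot,\cdot])$ is a vector space $V$ with a Lie bracket $[\cdot,\cdot]$ and a product $\circ$ such that $(V,\circ)$ is a Novikov algebra and $[a\circ b,c]-[a\circ c,b]+[a,b]\circ c-[a,c]\circ b-a\circ[b,c]=0$ for all $a,b,c\in V$. It is a known fact that $(V,\circ,[\cdot,\cdot]^-_k)$ is a Gel'fand-Dorfman bialgebra for every Novikov algebra $(V,\circ)$ and every $k\in\mathbb{C}$. The quadratic Lie conformal algebra corresponding to $(V,\circ,[\cdot,\cdot])$ is the free $\mathbb{C}[\partial]$-module $R=\mathbb{C}[\partial]V=\mathbb{C}[\partial]\otimes V$ with the $\lambda$-bracket determined by $[a_\lambda b]=\partial(b\circ a)+[b,a]+\lambda(a\circ b+b\circ a)$ for $a,b\in V$. The Lie conformal algebra corresponding to a Novikov algebra is the one corresponding to the Gel'fand-Dorfman bialgebra with zero Lie bracket. *)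

(* Defs.v *)
From HB Require Import structures.
From mathcomp Require Import all_boot all_order all_algebra finmap.
From mathcomp Require Import monalg classical_sets.
From mathcomp Require Import ring.

Set Implicit Arguments.
Unset Strict Implicit.
Unset Printing Implicit Defensive.

Import GRing.Theory.
Local Open Scope ring_scope.
Local Open Scope classical_set_scope.

(* polyM U = A[X] (x)_A U: finitely supported sequences in U,
   a module over {poly A} on which 'X acts as the shift. *)
Definition polyM (A : comNzRingType) (U : lmodType A) : Type := {malg U[nat]}.

Section PolyM.
Variables (A : comNzRingType) (U : lmodType A).
Implicit Types (p : {poly A}) (q : polyM U) (u : U).

HB.instance Definition _ := GRing.Zmodule.on (polyM U).

Definition mcoef q (n : nat) : U := mcoeff n (q : {malg U[nat]}).
Definition monoM (n : nat) u : polyM U := mkmalgU n u.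

Definition scaleM p q : polyM U :=
  \sum_(i < size p) \sum_(k <- msupp (q : {malg U[nat]}))
    monoM (i + k) (p`_i *: mcoef q k).

Fact polyM_eqP q1 q2 : (forall n, mcoef q1 n = mcoef q2 n) -> q1 = q2.
Proof. by move=> h; apply/malgP. Qed.

Fact mcoefD n : {morph mcoef^~ n : x y / x + y}.
Proof. by move=> x y; exact: mcoeffD. Qed.

Fact mcoef0 n : mcoef 0 n = 0.
Proof. exact: mcoeff0. Qed.

Fact mcoef_mono k u n : mcoef (monoM k u) n = if k == n then u else 0.
Proof. by rewrite /mcoef /monoM mcoeffU; case: eqP. Qed.

Fact mcoef_sum n I (r : seq I) (F : I -> polyM U) :
  mcoef (\sum_(i <- r) F i) n = \sum_(i <- r) mcoef (F i) n.
Proof. exact: (big_morph (mcoef^~ n) (mcoefD n) (mcoef0 n)). Qed.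

Fact polyM_eta q : q = \sum_(k <- msupp (q : {malg U[nat]})) monoM k (mcoef q k).
Proof. exact: (monalgE (q : {malg U[nat]})). Qed.

Fact polyM_ind0 (P : polyM U -> Prop) :
  (forall k u, P (monoM k u)) -> (forall q1 q2, P q1 -> P q2 -> P (q1 + q2)) ->
  forall q, P q.
Proof.
move=> Pm PD q; rewrite [q]polyM_eta.
elim/big_ind: _ => //; have -> : 0 = monoM 0 0; last exact: Pm.
by apply: polyM_eqP => n; rewrite mcoef0 mcoef_mono if_same.
Qed.

Fact mcoef_scale p q n :
  mcoef (scaleM p q) n = \sum_(i < n.+1) p`_i *: mcoef q (n - i).
Proof.
rewrite /scaleM mcoef_sum.
have H (i : nat) : mcoef (\sum_(k <- msupp (q : {malg U[nat]}))
    monoM (i + k) (p`_i *: mcoef q k)) n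
    = if (i <= n)%N then p`_i *: mcoef q (n - i) else 0.
  rewrite mcoef_sum; case: leqP => hin; last first.
    rewrite big1 // => k _; rewrite mcoef_mono; case: eqP => // e.
    by move: hin; rewrite -e ltnNge leq_addr.
  rewrite [in RHS](polyM_eta q) mcoef_sum scaler_sumr; apply: eq_bigr => k _.
  rewrite !mcoef_mono -{1}(subnKC hin) eqn_add2l.
  by case: eqP; rewrite ?scaler0.
under eq_bigr do rewrite H.
rewrite -(big_mkord xpredT (fun i => if (i <= n)%N then p`_i *: mcoef q (n - i) else 0)).
rewrite -(big_mkord xpredT (fun i => p`_i *: mcoef q (n - i))).
have E (m : nat) : (size p <= m)%N -> (n < m)%N ->
   \sum_(0 <= i < m) (if (i <= n)%N then p`_i *: mcoef q (n - i) else 0)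
   = \sum_(0 <= i < size p) (if (i <= n)%N then p`_i *: mcoef q (n - i) else 0) /\
   \sum_(0 <= i < m) (if (i <= n)%N then p`_i *: mcoef q (n - i) else 0)
   = \sum_(0 <= i < n.+1) p`_i *: mcoef q (n - i).
  move=> h1 h2; split.
    rewrite (big_cat_nat _ h1) //= [X in _ + X]big_nat_cond [X in _ + X]big1 ?addr0 //.
    by move=> i /andP[/andP[hi _] _]; rewrite (nth_default _ hi) scale0r if_same.
  rewrite (big_cat_nat _ h2) //= [X in _ + X]big_nat_cond [X in _ + X]big1 ?addr0.
    rewrite big_nat_cond [RHS]big_nat_cond; apply: eq_bigr => i /andP[/andP[_ hi] _].
    by rewrite -ltnS hi.
  by move=> i /andP[/andP[hi _] _]; rewrite leqNgt hi.
by have [<- ->] := E (maxn (size p) n.+1) (leq_maxl _ _) (leq_maxr _ _).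
Qed.

Fact scaleMA p1 p2 q : scaleM p1 (scaleM p2 q) = scaleM (p1 * p2) q.
Proof.
apply: polyM_eqP => i; rewrite [LHS]mcoef_scale.
have -> : mcoef (scaleM (p1 * p2) q) i =
   \sum_(k < i.+1) (p1 * p2)`_(i - k) *: mcoef q k.
  rewrite mcoef_scale (reindex_inj rev_ord_inj) /=.
  by apply: eq_bigr => k _; rewrite subKn ?leq_ord.
pose coef3 j k := (p1`_j * p2`_(i - j - k)%N) *: mcoef q k.
transitivity (\sum_(j < i.+1) \sum_(k < i.+1 | (k <= i - j)%N) coef3 j k).
  apply: eq_bigr => /= j _; rewrite mcoef_scale (reindex_inj rev_ord_inj) /=.
  rewrite scaler_sumr (big_ord_narrow_leq (leq_subr _ _)).
  by apply: eq_bigr => k _; rewrite scalerA subSS /coef3 /= subKn ?leq_ord.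
rewrite (exchange_big_dep predT) //=; apply: eq_bigr => k _.
transitivity (\sum_(j < i.+1 | (j <= i - k)%N) coef3 j k).
  by apply: eq_bigl => j; rewrite -ltnS -(ltnS j) -!subSn ?leq_ord // ltn_subCr.
rewrite (big_ord_narrow_leq (leq_subr _ _)) coefM scaler_suml.
by apply: eq_bigr => j _; rewrite /coef3 /= subnAC.
Qed.

Fact scaleM1 q : scaleM 1 q = q.
Proof.
apply: polyM_eqP => n; rewrite mcoef_scale big_ord_recl coefC /= scale1r subn0.
by rewrite big1 ?addr0 // => i _; rewrite coefC scale0r.
Qed.

Fact scaleMDr : right_distributive scaleM +%R.
Proof.
move=> p x y; apply: polyM_eqP => n; rewrite mcoefD !mcoef_scale -big_split.
by apply: eq_bigr => i _; rewrite mcoefD scalerDr.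
Qed.

Fact scaleMDl q : {morph scaleM^~ q : p1 p2 / p1 + p2}.
Proof.
move=> p1 p2; apply: polyM_eqP => n; rewrite mcoefD !mcoef_scale -big_split.
by apply: eq_bigr => i _; rewrite coefD scalerDl.
Qed.

HB.instance Definition _ :=
  GRing.Zmodule_isLmodule.Build {poly A} (polyM U) scaleMA scaleM1 scaleMDr scaleMDl.

Fact scaleXM k u : 'X *: monoM k u = monoM k.+1 u.
Proof.
apply: polyM_eqP => n; rewrite [LHS]mcoef_scale.
under eq_bigr => i _ do rewrite coefX mcoef_mono.
case: n => [|n]; first by rewrite big_ord1 scale0r mcoef_mono.
rewrite !big_ord_recl /= scale0r add0r scale1r subSS subn0 mcoef_mono eqSS.
by rewrite big1 ?addr0 // => i _; rewrite scale0r.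
Qed.

Fact scaleCM a q n : mcoef (a%:P *: q) n = a *: mcoef q n.
Proof.
rewrite [LHS]mcoef_scale big_ord_recl coefC /= subn0 big1 ?addr0 // => i _.
by rewrite coefC scale0r.
Qed.

Definition constM u : polyM U := monoM 0 u.

Fact monoMD k : {morph monoM k : x y / x + y}.
Proof. by move=> x y; exact: monalgUD. Qed.

Fact constMD : {morph constM : x y / x + y}.
Proof. exact: monoMD. Qed.

Fact constMN u : constM (- u) = - constM u.
Proof. exact: monalgUN. Qed.

Fact constMZ a u : constM (a *: u) = a%:P *: constM u.
Proof.
apply: polyM_eqP => n; rewrite scaleCM !mcoef_mono; case: eqP => // _.
by rewrite scaler0.
Qed.

Fact polyM_ind (P : polyM U -> Prop) :
  (forall u, P (constM u)) -> (forall q, P q -> P ('X *: q)) ->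
  (forall q1 q2, P q1 -> P q2 -> P (q1 + q2)) ->
  forall q, P q.
Proof.
move=> Pc PX PD; apply: polyM_ind0 => // k u.
by elim: k => [|k IH]; [exact: Pc | rewrite -scaleXM; exact: PX].
Qed.
End PolyM.

Section EvM.
Variables (A B : comNzRingType) (U : lmodType A) (W : lmodType B).

(* The value at 'X := p of q, its coefficients being moved to W by f. *)
Definition evM (f : U -> W) (p : B) (q : polyM U) : W :=
  \sum_(k <- msupp (q : {malg U[nat]})) p ^+ k *: f (mcoef q k).

Variables (f : U -> W) (p : B).
Hypothesis fD : {morph f : x y / x + y}.

Let f0 : f 0 = 0.
Proof. by apply: (@addrI _ (f 0)); rewrite -fD !addr0. Qed.

Fact evMw q (D : {fset nat}) : (msupp (q : {malg U[nat]}) `<=` D)%fset ->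
  evM f p q = \sum_(k <- D) p ^+ k *: f (mcoef q k).
Proof.
move=> h; apply: big_fset_incl => // k _ hk.
by rewrite /mcoef mcoeff_outdom // f0 scaler0.
Qed.

Fact evMD : {morph evM f p : x y / x + y}.
Proof.
move=> x y.
rewrite (@evMw x (msupp (x : {malg U[nat]}) `|` msupp (y : {malg U[nat]}))%fset) ?fsubsetUl //.
rewrite (@evMw y (msupp (x : {malg U[nat]}) `|` msupp (y : {malg U[nat]}))%fset) ?fsubsetUr //.
rewrite (@evMw (x + y) (msupp (x : {malg U[nat]}) `|` msupp (y : {malg U[nat]}))%fset) ?msuppD_le //.
by rewrite -big_split; apply: eq_bigr => k _; rewrite mcoefD fD scalerDr.
Qed.

Fact evM_mono k u : evM f p (monoM k u) = p ^+ k *: f u.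
Proof.
rewrite (@evMw _ [fset k]%fset) ?msuppU_le // big_seq_fset1 mcoef_mono eqxx //.
Qed.

Fact evMX q : evM f p ('X *: q) = p *: evM f p q.
Proof.
elim/polyM_ind0: q => [k u | x y hx hy].
  by rewrite scaleXM !evM_mono exprS scalerA.
by rewrite scalerDr !evMD hx hy scalerDr.
Qed.

Fact evM_const u : evM f p (constM u) = f u.
Proof. by rewrite evM_mono scale1r. Qed.

Fact evMC (a : A) (b : B) q : (forall u, f (a *: u) = b *: f u) ->
  evM f p (a%:P *: q) = b *: evM f p q.
Proof.
move=> fZ; elim/polyM_ind: q => [u | q hq | x y hx hy].
- by rewrite -constMZ !evM_const fZ.
- by rewrite scalerA mulrC -scalerA !evMX hq !scalerA mulrC.
- by rewrite scalerDr !evMD hx hy scalerDr.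
Qed.
End EvM.

Fact evM_addf (A B : comNzRingType) (U : lmodType A) (W : lmodType B)
    (f g : U -> W) (p : B) (q : polyM U) :
  evM (fun u => f u + g u) p q = evM f p q + evM g p q.
Proof. by rewrite -big_split; apply: eq_bigr => k _; rewrite scalerDr. Qed.

Fact evM_scalef (A B : comNzRingType) (U : lmodType A) (W : lmodType B)
    (f : U -> W) (b p : B) (q : polyM U) :
  evM (fun u => b *: f u) p q = b *: evM f p q.
Proof.
by rewrite scaler_sumr; apply: eq_bigr => k _; rewrite !scalerA mulrC.
Qed.

Fact eq_evM (A B : comNzRingType) (U : lmodType A) (W : lmodType B)
    (f g : U -> W) (p : B) (q : polyM U) : f =1 g -> evM f p q = evM g p q.
Proof. by move=> fg; apply: eq_bigr => k _; rewrite fg. Qed.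

Section Algebras.
Variables (K : fieldType) (V : lmodType K).

Record novikov := Novikov {
  nprod :> V -> V -> V;
  nprod_linearl : forall b, linear (nprod^~ b);
  nprod_linearr : forall a, linear (nprod a);
  nprod_lsym : forall a b c,
    nprod (nprod a b) c - nprod a (nprod b c)
    = nprod (nprod b a) c - nprod b (nprod a c);
  nprod_rcomm : forall a b c, nprod (nprod a b) c = nprod (nprod a c) b
}.

Definition novikov_ideal (N : novikov) (I : set V) : Prop :=
  [/\ I 0, forall (c : K) u v, I u -> I v -> I (c *: u + v)
    & forall a u, I u -> I (N a u) /\ I (N u a)].

Definition novikov_simple (N : novikov) : Prop :=
  (forall I, novikov_ideal N I -> I = [set 0] \/ I = setT) /\
  exists a b, N a b <> 0.

Record gdBialgebra := GDBialgebra {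
  gd_novikov :> novikov;
  gd_lie : V -> V -> V;
  gd_lie_linearl : forall b, linear (gd_lie^~ b);
  gd_lie_linearr : forall a, linear (gd_lie a);
  gd_lie_alt : forall a, gd_lie a a = 0;
  gd_lie_jacobi : forall a b c,
    gd_lie a (gd_lie b c) + gd_lie b (gd_lie c a) + gd_lie c (gd_lie a b) = 0;
  gd_compat : forall a b c,
    gd_lie (gd_novikov a b) c - gd_lie (gd_novikov a c) b
    + gd_novikov (gd_lie a b) c - gd_novikov (gd_lie a c) b
    - gd_novikov a (gd_lie b c) = 0
}.
End Algebras.

Section LieConformal.
Variable K : comNzRingType.

(* {poly K} is C[∂] and polyM R is R[lambda]: on R[lambda], lambda acts as 'X
   and ∂, which acts coefficientwise, as 'X%:P.  On R[lambda][mu] the scalars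
   mu, lambda and ∂ are 'X, 'X%:P and 'X%:P%:P.  K acts through constants. *)

(* [a _p b], with values in R[lambda][mu]. *)
Definition lbr_at (R : lmodType {poly K}) (br : R -> R -> polyM R)
    (p : {poly {poly {poly K}}}) (a b : R) : polyM (polyM R) :=
  evM (fun r => constM (constM r)) p (br a b).

Record lieConformal (R : lmodType {poly K}) := LieConformal {
  lbr :> R -> R -> polyM R;
  lbr_bilinl : forall (k : K) a a' b,
    lbr (k%:P *: a + a') b = k%:P%:P *: lbr a b + lbr a' b;
  lbr_bilinr : forall (k : K) a b b',
    lbr a (k%:P *: b + b') = k%:P%:P *: lbr a b + lbr a b';
  lbr_derivl : forall a b, lbr ('X *: a) b = - ('X *: lbr a b);
  lbr_derivr : forall a b, lbr a ('X *: b) = ('X + 'X%:P) *: lbr a b;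
  lbr_skew : forall a b,
    lbr a b = - evM (@constM _ R) (- 'X - 'X%:P) (lbr b a);
  lbr_jacobi : forall a b c,
    let lambda := 'X%:P in let mu := 'X in
    evM (lbr_at lbr lambda a) mu (lbr b c)
    = evM (fun r => lbr_at lbr (lambda + mu) r c) lambda (lbr a b)
      + evM (lbr_at lbr mu b) lambda (lbr a c)
}.

Variables (R : lmodType {poly K}) (L : lieConformal R).

Definition lc_subspace (S : set R) : Prop :=
  S 0 /\ forall (k : K) u v, S u -> S v -> S (k%:P *: u + v).

(* The span of the coefficients is over K, not over {poly K}. *)
Definition lc_bracket (A B : set R) : set R :=
  smallest lc_subspace [set r | exists a b n, [/\ A a, B b & r = mcoef (L a b) n]].

Definition lc_ideal (I : set R) : Prop :=
  [/\ I 0, forall (p : {poly K}) u v, I u -> I v -> I (p *: u + v)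
    & (lc_bracket setT I `<=` I)].

Definition lc_abelian : Prop := lc_bracket setT setT = [set 0].

Definition lc_simple : Prop :=
  ~ lc_abelian /\
  forall I, lc_ideal I -> I = [set 0] \/ I = [set: R].
End LieConformal.

(* Square-zero extension of A by U; it makes identities in the module U
   accessible to the ring tactic. *)
Definition sqz (A : comNzRingType) (U : lmodType A) : Type := (A * U)%type.

Section Sqz.
Variables (A : comNzRingType) (U : lmodType A).
HB.instance Definition _ := GRing.Zmodule.copy (sqz U) (A * U)%type.

Definition sqz_mul (x y : sqz U) : sqz U := (x.1 * y.1, x.1 *: y.2 + y.1 *: x.2).
Definition sqz_one : sqz U := (1, 0).

Fact sqz_mulA : associative sqz_mul.
Proof.
move=> [a u] [b v] [c w]; congr (_, _); rewrite /= ?mulrA //.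
by rewrite !scalerDr !scalerA -!addrA [c * a]mulrC [c * b]mulrC.
Qed.
Fact sqz_mulC : commutative sqz_mul.
Proof. by move=> [a u] [b v]; congr (_, _); rewrite /= ?(addrC (a *: v)) // mulrC. Qed.
Fact sqz_mul1 : left_id sqz_one sqz_mul.
Proof. by move=> [a u]; congr (_, _); rewrite /= ?mul1r // scaler0 addr0 scale1r. Qed.
Fact sqz_mulD : left_distributive sqz_mul +%R.
Proof.
move=> [a u] [b v] [c w]; congr (_, _); rewrite /= ?mulrDl //.
by rewrite scalerDl scalerDr addrACA.
Qed.
Fact sqz_one_neq0 : sqz_one != 0.
Proof. by apply/eqP => -[] /eqP; rewrite oner_eq0. Qed.

HB.instance Definition _ := GRing.Zmodule_isComNzRing.Build (sqz U)
  sqz_mulA sqz_mulC sqz_mul1 sqz_mulD sqz_one_neq0.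

Definition sqz_in (u : U) : sqz U := (0, u).
Definition sqz_sc (a : A) : sqz U := (a, 0).

Fact sqz_inj : injective sqz_in. Proof. by move=> u v []. Qed.
Fact sqz_in0 : sqz_in 0 = 0. Proof. by []. Qed.
Fact sqz_inD u v : sqz_in (u + v) = sqz_in u + sqz_in v.
Proof. by congr (_, _); rewrite /= ?addr0. Qed.
Fact sqz_inN u : sqz_in (- u) = - sqz_in u.
Proof. by congr (_, _); rewrite /= ?oppr0. Qed.
Fact sqz_inZ a u : sqz_in (a *: u) = sqz_sc a * sqz_in u.
Proof. by congr (_, _); rewrite /= ?mulr0 // scale0r addr0. Qed.
Fact sqz_scD a b : sqz_sc (a + b) = sqz_sc a + sqz_sc b.
Proof. by congr (_, _); rewrite /= addr0. Qed.
Fact sqz_scN a : sqz_sc (- a) = - sqz_sc a.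
Proof. by congr (_, _); rewrite /= oppr0. Qed.
Fact sqz_scM a b : sqz_sc (a * b) = sqz_sc a * sqz_sc b.
Proof. by congr (_, _); rewrite /= !scaler0 addr0. Qed.
Definition sqzE := (sqz_in0, sqz_inD, sqz_inN, sqz_inZ, sqz_scD, sqz_scN, sqz_scM).
End Sqz.

Section GD.
Variables (K : fieldType) (V : lmodType K).

Section Lin.
Variables (f : V -> V -> V).
Hypotheses (fl : forall b, linear (f^~ b)) (fr : forall a, linear (f a)).
Fact lin2Dl a b c : f (a + b) c = f a c + f b c.
Proof. by rewrite -{1}[a]scale1r fl scale1r. Qed.
Fact lin2Dr a b c : f a (b + c) = f a b + f a c.
Proof. by rewrite -{1}[b]scale1r fr scale1r. Qed.
Fact lin20l c : f 0 c = 0. Proof. by apply: (@addrI _ (f 0 c)); rewrite -lin2Dl !addr0. Qed.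
Fact lin20r c : f c 0 = 0. Proof. by apply: (@addrI _ (f c 0)); rewrite -lin2Dr !addr0. Qed.
Fact lin2Zl k a c : f (k *: a) c = k *: f a c.
Proof. by rewrite -{1}[k *: a]addr0 fl lin20l addr0. Qed.
Fact lin2Zr k a c : f a (k *: c) = k *: f a c.
Proof. by rewrite -{1}[k *: c]addr0 fr lin20r addr0. Qed.
Fact lin2Nl a c : f (- a) c = - f a c.
Proof. by rewrite -scaleN1r lin2Zl scaleN1r. Qed.
Fact lin2Nr a c : f a (- c) = - f a c.
Proof. by rewrite -scaleN1r lin2Zr scaleN1r. Qed.
Definition lin2E := (lin2Dl, lin2Dr, lin2Zl, lin2Zr, lin2Nl, lin2Nr).
End Lin.

Variable N : novikov V.
Definition novE := (lin2E (nprod_linearl N) (nprod_linearr N)).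

Definition minus_bracket (k : K) (a b : V) : V := k *: (N a b - N b a).

Fact nov_sub a b c : N a (N b c) = N (N a b) c - N (N b a) c + N b (N a c).
Proof.
have h := nprod_lsym N a b c; apply/eqP; rewrite -subr_eq0.
have -> : N a (N b c) - (N (N a b) c - N (N b a) c + N b (N a c))
   = (N (N b a) c - N b (N a c)) - (N (N a b) c - N a (N b c)).
  by apply: sqz_inj; rewrite !sqzE; ring.
by rewrite h subrr.
Qed.

Fact minus_linearl k b : linear ((minus_bracket k)^~ b).
Proof.
by move=> c x y; apply: sqz_inj; rewrite /minus_bracket !novE !sqzE; ring.
Qed.

Fact minus_linearr k a : linear (minus_bracket k a).
Proof.
by move=> c x y; apply: sqz_inj; rewrite /minus_bracket !novE !sqzE; ring.
Qed.

Fact minus_alt k a : minus_bracket k a a = 0.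
Proof. by rewrite /minus_bracket subrr scaler0. Qed.

Fact minus_jacobi k a b c :
  minus_bracket k a (minus_bracket k b c) + minus_bracket k b (minus_bracket k c a)
  + minus_bracket k c (minus_bracket k a b) = 0.
Proof.
apply: sqz_inj; rewrite /minus_bracket !novE !sqzE.
rewrite (nov_sub a b c) (nov_sub a c b) (nov_sub b c a).
by rewrite !sqzE; ring.
Qed.

Fact minus_compat k a b c :
  minus_bracket k (N a b) c - minus_bracket k (N a c) b
  + N (minus_bracket k a b) c - N (minus_bracket k a c) b
  - N a (minus_bracket k b c) = 0.
Proof.
apply: sqz_inj; rewrite /minus_bracket !novE !sqzE.
rewrite (nov_sub a b c) (nov_sub a c b) (nprod_rcomm N a c b).
by rewrite !sqzE; ring.
Qed.

Definition gd_minus (k : K) : gdBialgebra V :=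
  GDBialgebra (@minus_linearl k) (@minus_linearr k) (@minus_alt k)
    (@minus_jacobi k) (@minus_compat k).

Definition zero_bracket (a b : V) : V := 0.

Fact zero_linearl b : linear (zero_bracket^~ b).
Proof. by move=> c x y; rewrite scaler0 addr0. Qed.
Fact zero_linearr a : linear (zero_bracket a).
Proof. by move=> c x y; rewrite scaler0 addr0. Qed.
Fact zero_alt a : zero_bracket a a = 0. Proof. by []. Qed.
Fact zero_jacobi a b c :
  zero_bracket a (zero_bracket b c) + zero_bracket b (zero_bracket c a)
  + zero_bracket c (zero_bracket a b) = 0.
Proof. by rewrite !addr0. Qed.
Fact zero_compat a b c :
  zero_bracket (N a b) c - zero_bracket (N a c) b
  + N (zero_bracket a b) c - N (zero_bracket a c) b - N a (zero_bracket b c) = 0.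
Proof.
rewrite /zero_bracket !(lin20l (nprod_linearl N)) (lin20r (nprod_linearr N)).
by rewrite !subr0 !addr0.
Qed.

Definition gd_zero : gdBialgebra V :=
  GDBialgebra zero_linearl zero_linearr zero_alt zero_jacobi zero_compat.
End GD.

Section EvMTransfer.
Variables (A B : comNzRingType) (U : lmodType A) (W : lmodType B).
Implicit Types (f : U -> W) (p b : B) (q : polyM U).

Fact evMN f p (fD : {morph f : x y / x + y}) q : evM f p (- q) = - evM f p q.
Proof.
apply: (@addrI _ (evM f p q)); rewrite -evMD // !subrr.
by apply: (@addrI _ (evM f p 0)); rewrite -evMD // !addr0.
Qed.

Fact evM_scalefE f g b p q : (forall u, f u = b *: g u) ->
  evM f p q = b *: evM g p q.
Proof. by move=> fg; rewrite (eq_evM _ _ fg) evM_scalef. Qed.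

Fact evM_addfE f g h p q : (forall u, f u = g u + h u) ->
  evM f p q = evM g p q + evM h p q.
Proof. by move=> fg; rewrite (eq_evM _ _ fg) evM_addf. Qed.

Fact evMDE f p q q1 q2 : {morph f : x y / x + y} -> q = q1 + q2 ->
  evM f p q = evM f p q1 + evM f p q2.
Proof. by move=> fD ->; rewrite evMD. Qed.

Fact evMXNE f p q q1 : {morph f : x y / x + y} -> q = - ('X *: q1) ->
  evM f p q = (- p) *: evM f p q1.
Proof. by move=> fD ->; rewrite evMN // evMX // scaleNr. Qed.

Fact evMXCE f p (a : A) b c q q1 : {morph f : x y / x + y} ->
  (forall u, f (a *: u) = b *: f u) -> q = ('X + a%:P) *: q1 -> c = p + b ->
  evM f p q = c *: evM f p q1.
Proof.
by move=> fD fZ -> ->; rewrite scalerDl evMD // evMX // (evMC _ fD _ fZ) // -scalerDl.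
Qed.

Fact evM_gen f p (a : A) b x y z : {morph f : x y / x + y} ->
  (forall u, f (a *: u) = b *: f u) ->
  evM f p (a%:P *: constM x + constM y + 'X *: constM z)
  = b *: f x + f y + p *: f z.
Proof.
by move=> fD fZ; rewrite !evMD // evMX // (evMC _ fD _ fZ) // !evM_const.
Qed.

Fact evM_genE f p (a : A) b x y z u v w : {morph f : x y / x + y} ->
  (forall u, f (a *: u) = b *: f u) -> f x = u -> f y = v -> f z = w ->
  evM f p (a%:P *: constM x + constM y + 'X *: constM z) = b *: u + v + p *: w.
Proof. by move=> fD fZ <- <- <-; exact: evM_gen. Qed.
End EvMTransfer.

Section ModuleIdentities.
Variables (A : comNzRingType) (W : lmodType A).
Implicit Types (d l m k : A) (x y z w : W).

Fact gen_add d l x1 x2 y1 y2 z1 z2 w1 w2 :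
  d *: (x1 + x2) + (y1 + y2) + l *: ((z1 + z2) + (w1 + w2))
  = (d *: x1 + y1 + l *: (z1 + w1)) + (d *: x2 + y2 + l *: (z2 + w2)).
Proof. by apply: sqz_inj; rewrite !sqzE; ring. Qed.

Fact gen_scale d l k x y z w :
  d *: (k *: x) + k *: y + l *: (k *: z + k *: w)
  = k *: (d *: x + y + l *: (z + w)).
Proof. by apply: sqz_inj; rewrite !sqzE; ring. Qed.

Fact gen_skew d l x y z :
  (d *: x - y + l *: (z + x)) + (d *: z + y + (- l - d) *: (x + z)) = 0.
Proof. by apply: sqz_inj; rewrite !sqzE; ring. Qed.

Variables (K : fieldType) (V : lmodType K) (G : gdBialgebra V) (t : V -> W).
Hypotheses (tD : {morph t : x y / x + y}) (tN : {morph t : x / - x}).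

Fact gd_lieC a b : gd_lie G b a = - gd_lie G a b.
Proof.
apply/eqP; rewrite -addr_eq0; apply/eqP; have := gd_lie_alt G (a + b).
rewrite !(lin2E (gd_lie_linearl G) (gd_lie_linearr G)).
by rewrite !gd_lie_alt add0r addr0 addrC.
Qed.

Local Notation B := (gd_lie G).

Fact gen_jacobi d l m a b c :
  let g p (x y : V) := d *: t (G y x) + t (gd_lie G y x) + p *: t (G x y + G y x) in
  (l + d) *: g l a (G c b) + g l a (gd_lie G c b) + m *: g l a (G b c + G c b)
  - ((- (l + m) *: g (l + m) (G b a) c + g (l + m) (gd_lie G b a) c
      + l *: g (l + m) (G a b + G b a) c)
    + ((m + d) *: g m b (G c a) + g m b (gd_lie G c a)
      + l *: g m b (G a c + G c a))) = 0.
Proof.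
move=> g; rewrite /g {g}; apply: sqz_inj.
have nE := lin2E (nprod_linearl G) (nprod_linearr G).
have lE := lin2E (gd_lie_linearl G) (gd_lie_linearr G).
have hL : B (B b c) a = B (B a c) b - B (B a b) c.
  apply/eqP; rewrite -subr_eq0 -oppr_eq0 -(gd_lie_jacobi G a b c); apply/eqP.
  rewrite (gd_lieC a c) !lE (gd_lieC (gd_lie G a b) c).
  rewrite (gd_lieC (gd_lie G b c) a) (gd_lieC (gd_lie G a c) b).
  by apply: sqz_inj; rewrite !sqzE; ring.
have h1 (x y z : V) :
    G x (B y z) = B (G x y) z - B (G x z) y + G (B x y) z - G (B x z) y.
  by apply/eqP; rewrite eq_sym -subr_eq0 gd_compat.
rewrite (gd_lieC b c) (gd_lieC a b) (gd_lieC a c).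
rewrite !nE !lE.
have BC (x y z : V) : B x (G y z) = - B (G y z) x by exact: gd_lieC.
have BB (x y z : V) : B x (B y z) = - B (B y z) x by exact: gd_lieC.
rewrite !BB !BC hL !h1.
rewrite ?(gd_lieC b c) ?(gd_lieC a b) ?(gd_lieC a c) !nE.
rewrite (nov_sub G a b c) (nov_sub G a c b) (nov_sub G b c a).
rewrite (nprod_rcomm G c b a) (nprod_rcomm G b c a) (nprod_rcomm G a c b).
rewrite !(tD, tN) !sqzE.
by ring.
Qed.
End ModuleIdentities.

Section Sesquilinear.
Variables (K : comNzRingType) (R : lmodType {poly K}) (br : R -> R -> polyM R).
Hypotheses (brDl : forall b, {morph br^~ b : x y / x + y})
  (brDr : forall a, {morph br a : x y / x + y})
  (brXl : forall a b, br ('X *: a) b = - ('X *: br a b))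
  (brXr : forall a b, br a ('X *: b) = ('X + 'X%:P) *: br a b).

Let P3 : comNzRingType := {poly {poly {poly K}}}.
Let W := polyM (polyM R).
Let cc (r : R) : W := constM (constM r).

Let ccD : {morph cc : x y / x + y}.
Proof. by move=> x y; rewrite /cc !constMD. Qed.
Let ccX r : cc ('X *: r) = 'X%:P%:P *: cc r.
Proof. by rewrite /cc !constMZ. Qed.

Fact lbrDl p b : {morph (lbr_at br p)^~ b : x y / x + y}.
Proof. by move=> x y; rewrite /lbr_at brDl evMD. Qed.
Fact lbrDr p a : {morph lbr_at br p a : x y / x + y}.
Proof. by move=> x y; rewrite /lbr_at brDr evMD. Qed.
Fact lbrXl p a b : lbr_at br p ('X *: a) b = (- p) *: lbr_at br p a b.
Proof. by rewrite /lbr_at brXl evMN // evMX // scaleNr. Qed.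
Fact lbrXr p a b :
  lbr_at br p a ('X *: b) = (p + 'X%:P%:P) *: lbr_at br p a b.
Proof.
by rewrite /lbr_at brXr scalerDl evMD // evMX // (evMC _ _ _ ccX) // -scalerDl.
Qed.

Let la : P3 := 'X%:P.
Let mu : P3 := 'X.
Let pa : P3 := 'X%:P%:P.

Definition jac1 a b c : W := evM (lbr_at br la a) mu (br b c).
Definition jac2 a b c : W := evM (fun r => lbr_at br (la + mu) r c) la (br a b).
Definition jac3 a b c : W := evM (lbr_at br mu b) la (br a c).
Definition jac a b c : W := jac1 a b c - (jac2 a b c + jac3 a b c).

Let jac_scale (k : P3) (u v w u' v' w' : W) : u' = k *: u -> v' = k *: v ->
  w' = k *: w -> u' - (v' + w') = k *: (u - (v + w)).
Proof. by move=> -> -> ->; rewrite scalerBr scalerDr. Qed.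

Let jac_add (u1 u2 u v1 v2 v w1 w2 w : W) :
  u = u1 + u2 -> v = v1 + v2 -> w = w1 + w2 ->
  u - (v + w) = (u1 - (v1 + w1)) + (u2 - (v2 + w2)).
Proof. by move=> -> -> ->; rewrite (addrACA v1) opprD addrACA. Qed.

Fact jacX1 a b c : jac ('X *: a) b c = (- la) *: jac a b c.
Proof.
apply: jac_scale.
- by apply: evM_scalefE => r; exact: lbrXl.
- by apply: evMXNE; [exact: lbrDl | exact: brXl].
- by apply: evMXNE; [exact: lbrDr | exact: brXl].
Qed.

Fact jacX2 a b c : jac a ('X *: b) c = (- mu) *: jac a b c.
Proof.
apply: jac_scale.
- by apply: evMXNE; [exact: lbrDr | exact: brXl].
- apply: evMXCE (brXr _ _) _; [exact: lbrDl | by move=> r; exact: lbrXl |].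
  by rewrite opprD addrA subrr add0r.
- by apply: evM_scalefE => r; exact: lbrXl.
Qed.

Fact jacX3 a b c : jac a b ('X *: c) = (la + mu + pa) *: jac a b c.
Proof.
apply: jac_scale.
- apply: evMXCE (brXr _ _) _; [exact: lbrDr | by move=> r; exact: lbrXr |].
  by rewrite addrCA addrA.
- by apply: evM_scalefE => r; exact: lbrXr.
- apply: evMXCE (brXr _ _) _; [exact: lbrDr | by move=> r; exact: lbrXr |].
  by rewrite addrA.
Qed.

Fact jacD1 b c : {morph (fun a => jac a b c) : x y / x + y}.
Proof.
move=> x y; apply: jac_add.
- by apply: evM_addfE => r; exact: lbrDl.
- by apply: evMDE; [exact: lbrDl | exact: brDl].
- by apply: evMDE; [exact: lbrDr | exact: brDl].
Qed.
Fact jacD2 a c : {morph (fun b => jac a b c) : x y / x + y}.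
Proof.
move=> x y; apply: jac_add.
- by apply: evMDE; [exact: lbrDr | exact: brDl].
- by apply: evMDE; [exact: lbrDl | exact: brDr].
- by apply: evM_addfE => r; exact: lbrDl.
Qed.
Fact jacD3 a b : {morph (fun c => jac a b c) : x y / x + y}.
Proof.
move=> x y; apply: jac_add.
- by apply: evMDE; [exact: lbrDr | exact: brDr].
- by apply: evM_addfE => r; exact: lbrDr.
- by apply: evMDE; [exact: lbrDr | exact: brDr].
Qed.

Let phi : polyM R -> polyM R := evM (@constM _ R) (- 'X - 'X%:P).
Definition skew a b : polyM R := br a b + phi (br b a).

Let constD : {morph @constM _ R : x y / x + y}.
Proof. exact: constMD. Qed.
Let constX r : @constM _ R ('X *: r) = 'X%:P *: constM r.
Proof. exact: constMZ. Qed.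

Fact skewX1 a b : skew ('X *: a) b = (- 'X) *: skew a b.
Proof.
rewrite /skew scalerDr brXl brXr scaleNr; congr (_ + _).
rewrite /phi scalerDl evMD // evMX // (evMC _ _ _ constX) //.
by rewrite -scalerDl subrK.
Qed.
Fact skewX2 a b : skew a ('X *: b) = ('X + 'X%:P) *: skew a b.
Proof.
rewrite /skew scalerDr brXl brXr; congr (_ + _).
by rewrite /phi evMN // evMX // -scaleNr opprB opprK addrC.
Qed.
Fact skewD1 b : {morph skew^~ b : x y / x + y}.
Proof. by move=> x y; rewrite /skew brDl brDr /phi evMD // addrACA. Qed.
Fact skewD2 a : {morph skew a : x y / x + y}.
Proof. by move=> x y; rewrite /skew brDl brDr /phi evMD // addrACA. Qed.
End Sesquilinear.

Section Quadratic.
Variables (K : fieldType) (V : lmodType K) (G : gdBialgebra V).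

Let R := polyM V.

Definition quad_gen (a b : V) : polyM (polyM V) :=
  'X%:P *: constM (constM (G b a)) + constM (constM (gd_lie G b a))
  + 'X *: constM (constM (G a b + G b a)).

(* The extension of quad_gen by sesquilinearity: for a, b in V,
   [(∂^i a) _lambda (∂^j b)] = (- lambda)^i (lambda + ∂)^j [a _lambda b]. *)
Definition quad_br (x y : polyM V) : polyM (polyM V) :=
  evM (fun a => evM (quad_gen a) ('X + 'X%:P) y) (- 'X) x.

Let nE := lin2E (nprod_linearl G) (nprod_linearr G).
Let lE := lin2E (gd_lie_linearl G) (gd_lie_linearr G).

Fact quad_genDl b : {morph quad_gen^~ b : x y / x + y}.
Proof. by move=> x y; rewrite /quad_gen !nE !lE !constMD gen_add. Qed.
Fact quad_genDr a : {morph quad_gen a : x y / x + y}.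
Proof. by move=> x y; rewrite /quad_gen !nE !lE !constMD gen_add. Qed.
Fact quad_genZl k a b : quad_gen (k *: a) b = k%:P%:P *: quad_gen a b.
Proof. by rewrite /quad_gen !nE !lE !constMD !constMZ gen_scale. Qed.
Fact quad_genZr k a b : quad_gen a (k *: b) = k%:P%:P *: quad_gen a b.
Proof. by rewrite /quad_gen !nE !lE !constMD !constMZ gen_scale. Qed.

Let innerD y : {morph (fun a => evM (quad_gen a) ('X + 'X%:P) y) : a b / a + b}.
Proof.
by move=> a b; rewrite -evM_addf; apply: eq_evM => u; rewrite quad_genDl.
Qed.

Fact quad_brDl y : {morph quad_br^~ y : a b / a + b}.
Proof. by move=> a b; rewrite /quad_br evMD. Qed.
Fact quad_brDr x : {morph quad_br x : a b / a + b}.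
Proof.
move=> a b; rewrite /quad_br -evM_addf; apply: eq_evM => u.
by rewrite evMD //; exact: quad_genDr.
Qed.
Fact quad_brXl a b : quad_br ('X *: a) b = - ('X *: quad_br a b).
Proof. by rewrite /quad_br evMX // scaleNr. Qed.
Fact quad_brXr a b : quad_br a ('X *: b) = ('X + 'X%:P) *: quad_br a b.
Proof.
rewrite /quad_br -evM_scalef; apply: eq_evM => u; rewrite evMX //.
exact: quad_genDr.
Qed.
Fact quad_brZl k a b : quad_br (k%:P *: a) b = k%:P%:P *: quad_br a b.
Proof.
rewrite /quad_br; apply: evMC => // u; rewrite -evM_scalef; apply: eq_evM => v.
exact: quad_genZl.
Qed.
Fact quad_brZr k a b : quad_br a (k%:P *: b) = k%:P%:P *: quad_br a b.
Proof.
rewrite /quad_br -evM_scalef; apply: eq_evM => u.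
by apply: evMC => [|v]; [exact: quad_genDr | exact: quad_genZr].
Qed.
Fact quad_br_bilinl (k : K) a a' b :
  quad_br (k%:P *: a + a') b = k%:P%:P *: quad_br a b + quad_br a' b.
Proof. by rewrite quad_brDl quad_brZl. Qed.
Fact quad_br_bilinr (k : K) a b b' :
  quad_br a (k%:P *: b + b') = k%:P%:P *: quad_br a b + quad_br a b'.
Proof. by rewrite quad_brDr quad_brZr. Qed.

Fact quad_br_gen a b : quad_br (constM a) (constM b) = quad_gen a b.
Proof. by rewrite /quad_br evM_const // evM_const //; exact: quad_genDr. Qed.

Fact quad_skew a b :
  quad_br a b = - evM (@constM _ R) (- 'X - 'X%:P) (quad_br b a).
Proof.
apply/eqP; rewrite -addr_eq0; apply/eqP; rewrite -/(skew quad_br a b).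
have D1 := skewD1 quad_brDl quad_brDr; have D2 := skewD2 quad_brDl quad_brDr.
have X1 := skewX1 quad_brXl quad_brXr; have X2 := skewX2 quad_brXl quad_brXr.
elim/polyM_ind: a => [a | x h | x y hx hy]; last 2 first.
- by rewrite X1 h scaler0.
- by rewrite D1 hx hy addr0.
elim/polyM_ind: b => [b | x h | x y hx hy]; last 2 first.
- by rewrite X2 h scaler0.
- by rewrite D2 hx hy addr0.
rewrite /skew !quad_br_gen [X in evM _ _ X]/quad_gen.
rewrite (@evM_gen _ _ _ _ _ _ _ 'X%:P); [| exact: constMD | exact: constMZ].
by rewrite /quad_gen (gd_lieC G a b) !constMD !constMN gen_skew.
Qed.

Fact quad_jacobi a b c :
    let lambda := 'X%:P in let mu := 'X in
    evM (lbr_at quad_br lambda a) mu (quad_br b c)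
    = evM (fun r => lbr_at quad_br (lambda + mu) r c) lambda (quad_br a b)
      + evM (lbr_at quad_br mu b) lambda (quad_br a c).
Proof.
move=> /=; apply/eqP; rewrite -subr_eq0; apply/eqP.
rewrite -/(jac quad_br a b c).
elim/polyM_ind: a => [a | x h | x y hx hy]; last 2 first.
- by rewrite (jacX1 quad_brDl quad_brDr quad_brXl) h scaler0.
- by rewrite (jacD1 quad_brDl quad_brDr) hx hy addr0.
elim/polyM_ind: b => [b | x h | x y hx hy]; last 2 first.
- by rewrite (jacX2 quad_brDl quad_brDr quad_brXl quad_brXr) h scaler0.
- by rewrite (jacD2 quad_brDl quad_brDr) hx hy addr0.
elim/polyM_ind: c => [c | x h | x y hx hy]; last 2 first.
- by rewrite (jacX3 quad_brDr quad_brXr) h scaler0.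
- by rewrite (jacD3 quad_brDr) hx hy addr0.
pose W := polyM (polyM R).
pose c3 (v : V) : W := constM (constM (constM v)).
have c3D : {morph c3 : x y / x + y} by move=> x y; rewrite /c3 !constMD.
have c3N : {morph c3 : x / - x} by move=> x; rewrite /c3 !constMN.
pose la : {poly {poly {poly K}}} := 'X%:P.
pose mu : {poly {poly {poly K}}} := 'X.
pose pa : {poly {poly {poly K}}} := 'X%:P%:P.
pose g p x y : W :=
  'X%:P%:P *: c3 (G y x) + c3 (gd_lie G y x) + p *: c3 (G x y + G y x).
have gen p x y : lbr_at quad_br p (constM x) (constM y) = g p x y.
  rewrite /lbr_at quad_br_gen /quad_gen (@evM_gen _ _ _ _ _ _ _ 'X%:P%:P) //.
    by move=> u v; rewrite !constMD.
  by move=> u; rewrite !constMZ.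
have E1 : jac1 quad_br (constM a) (constM b) (constM c) =
   (la + pa) *: g la a (G c b) + g la a (gd_lie G c b)
   + mu *: g la a (G b c + G c b).
  rewrite /jac1 quad_br_gen /quad_gen.
  apply: (evM_genE _ (lbrDr quad_brDr _ _)
    (fun u => lbrXr quad_brXr _ _ u)); exact: gen.
have E2 : jac2 quad_br (constM a) (constM b) (constM c) =
   - (la + mu) *: g (la + mu) (G b a) c + g (la + mu) (gd_lie G b a) c
   + la *: g (la + mu) (G a b + G b a) c.
  rewrite /jac2 quad_br_gen /quad_gen.
  apply: (evM_genE _ (lbrDl quad_brDl _ _)
    (fun u => lbrXl quad_brXl _ u _)); exact: gen.
have E3 : jac3 quad_br (constM a) (constM b) (constM c) =
   (mu + pa) *: g mu b (G c a) + g mu b (gd_lie G c a)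
   + la *: g mu b (G a c + G c a).
  rewrite /jac3 quad_br_gen /quad_gen.
  apply: (evM_genE _ (lbrDr quad_brDr _ _)
    (fun u => lbrXr quad_brXr _ _ u)); exact: gen.
by rewrite /jac E1 E2 E3; exact: gen_jacobi.
Qed.

Definition quadratic_lca : lieConformal (polyM V) :=
  @LieConformal K (polyM V) quad_br quad_br_bilinl quad_br_bilinr
    quad_brXl quad_brXr quad_skew quad_jacobi.
End Quadratic.

Definition novikov_lca (K : fieldType) (V : lmodType K) (N : novikov V) :
  lieConformal (polyM V) := quadratic_lca (gd_zero N).

(* Main.v *)
(** If [I] is an ideal of the Novikov algebra, then the elements of
    [C[∂]V] with all coefficients in [I] form an ideal of the quadratic Lie
    conformal algebra, because a Novikov ideal absorbs the bracket
    [k (a ∘ b - b ∘ a)]; simplicity makes this ideal, hence [I], trivial.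
    If the product vanished, so would the Lie bracket and the [λ]-bracket. *)
Require Import Defs.
From mathcomp Require Import all_boot all_algebra reals complex.
From mathcomp Require Import boolp classical_sets.

Set Implicit Arguments.
Unset Strict Implicit.
Unset Printing Implicit Defensive.

Import GRing.Theory.
Local Open Scope ring_scope.
Local Open Scope complex_scope.

Section Submodules.
Local Open Scope classical_set_scope.

(** The ring [A] stays arbitrary because the same closure facts are needed over [K], [{poly K}] and
    [{poly {poly K}}]. *)
Definition submod_set (A : comNzRingType) (U : lmodType A) (S : set U) : Prop :=
  S 0 /\ forall (c : A) u v, S u -> S v -> S (c *: u + v).

(** This is [S[X]] inside [U[X]]; starting from [I] in [V], one level is [I[∂]] and two levels are
    [I[∂][λ]]. *)
Definition coefs_in (A : comNzRingType) (U : lmodType A) (S : set U) :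
  set (polyM U) := [set q | forall n, S (mcoef q n)].

Section Closure.
Variables (A : comNzRingType) (U : lmodType A) (S : set U).
Hypothesis S_submod : submod_set S.

Lemma submod_setD u v : S u -> S v -> S (u + v).
Proof. by move=> Su Sv; rewrite -[u]scale1r; apply: S_submod.2. Qed.

Lemma submod_setZ c u : S u -> S (c *: u).
Proof.
by move=> Su; rewrite -[_ *: _]addr0; apply: S_submod.2 => //; exact: S_submod.1.
Qed.

Lemma submod_set_sum (J : Type) (r : seq J) (F : J -> U) :
  (forall j, S (F j)) -> S (\sum_(j <- r) F j).
Proof.
by move=> SF; apply: big_ind => //; [exact: S_submod.1 | exact: submod_setD].
Qed.

Lemma coefs_in_submod : submod_set (coefs_in S).
Proof.
split=> [n|p u v Su Sv n]; first by rewrite mcoef0; exact: S_submod.1.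
rewrite mcoefD; apply: submod_setD (Sv n); rewrite [mcoef _ _]mcoef_scale.
by apply: submod_set_sum => i; exact: submod_setZ.
Qed.

Lemma coefs_in_constM u : S u -> coefs_in S (constM u).
Proof.
by move=> Su n; rewrite mcoef_mono; case: ifP => // _; exact: S_submod.1.
Qed.
End Closure.

Lemma submod_set_evM (A B : comNzRingType) (U : lmodType A) (W : lmodType B)
    (S : set W) (f : U -> W) (p : B) (q : polyM U) :
  submod_set S -> (forall n, S (f (mcoef q n))) -> S (evM f p q).
Proof.
by move=> hS Sf; apply: submod_set_sum => // k; exact: submod_setZ.
Qed.

Lemma submod_set0 (A : comNzRingType) (U : lmodType A) :
  submod_set [set 0 : U].
Proof. by split=> // c u v -> ->; rewrite scaler0 addr0. Qed.
End Submodules.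

Section QuadraticIdeals.
Local Open Scope classical_set_scope.
Variables (K : fieldType) (V : lmodType K) (G : gdBialgebra V).

(** [quad_br] is a double [evM] of [quad_gen], so only products and brackets of coefficients occur.
    A hypothesis on pairs of coefficients serves two cases: [y] over the ideal, and a vanishing
    product. *)
Lemma quad_br_coefs_in (I : set V) (x y : polyM V) : submod_set I ->
  (forall m n, [/\ I (G (mcoef x m) (mcoef y n)), I (G (mcoef y n) (mcoef x m))
                 & I (gd_lie G (mcoef y n) (mcoef x m))]) ->
  coefs_in (coefs_in I) (quad_br G x y).
Proof.
move=> hI hxy; have h1 := coefs_in_submod hI; have h2 := coefs_in_submod h1.
have cst v : I v -> coefs_in (coefs_in I) (constM (constM v)).
  by move=> Iv; exact: (coefs_in_constM h1 (coefs_in_constM hI Iv)).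
apply: submod_set_evM => // m; apply: submod_set_evM => // n.
have [Ixy Iyx Lyx] := hxy m n.
apply: (submod_setD h2); first apply: (submod_setD h2).
- by apply: (submod_setZ h2); exact: cst.
- exact: cst.
- by apply: (submod_setZ h2); apply: cst; exact: submod_setD.
Qed.

(** [coefs_in I] is stable under [{poly K}], hence under the constants [k%:P], so it contains the
    [K]-span of coefficients lying in it. *)
Lemma lc_bracket_coefs_in (I : set V) (A B : set (polyM V)) : submod_set I ->
  (forall x y, A x -> B y -> coefs_in (coefs_in I) (quad_br G x y)) ->
  lc_bracket (quadratic_lca G) A B `<=` coefs_in I.
Proof.
move=> hI hAB; have [z c] := coefs_in_submod hI.
apply: smallest_sub => [|_ [x [y [n [Ax By ->]]]]]; last exact: hAB.
by split=> // k; exact: c.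
Qed.

(* Applied to the zero ideal, the hypothesis says that a vanishing product
   forces a vanishing Lie bracket. *)
Lemma quadratic_lca_simple :
  (forall I : set V, novikov_ideal G I ->
     forall a b, I (G a b) -> I (G b a) -> I (gd_lie G a b)) ->
  lc_simple (quadratic_lca G) -> novikov_simple G.
Proof.
move=> lieI [nonabelian simpleR]; split=> [I idI|].
  have [I0 Ic Im] := idI; have hI : submod_set I by [].
  have [J0 Jc] := coefs_in_submod hI.
  have idJ : lc_ideal (quadratic_lca G) (coefs_in I).
    split=> //; apply: lc_bracket_coefs_in => // x y _ Jy.
    apply: quad_br_coefs_in => // m n.
    have [Ixy Iyx] := Im (mcoef x m) _ (Jy n).
    by split=> //; exact: lieI.
  (* Either equality descends to [I] through the degree 0 coefficient of [constM u]. *)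
  have [J_eq|J_eq] := simpleR _ idJ; [left|right]; apply/seteqP; split=> // u.
  - move=> Iu; have := coefs_in_constM hI Iu; rewrite J_eq => u0 /=.
    by have := mcoef_mono 0 u 0; rewrite -/(constM u) u0 mcoef0.
  - by move=> ->.
  - move=> _; have : coefs_in I (constM u) by rewrite J_eq.
    by move=> /(_ 0%N); rewrite mcoef_mono.
apply: contrapT => noprod; apply: nonabelian.
have G0 a b : G a b = 0.
  by apply: contrapT => ab0; apply: noprod; exists a, b.
have [Z0 Zc] := @submod_set0 _ V.
have L0 a b : gd_lie G a b = 0.
  apply: (lieI [set 0]); rewrite ?G0 //; split=> // c u _.
  by rewrite !G0.
apply/seteqP; split=> [r|_ ->].
  have sub0 : lc_bracket (quadratic_lca G) setT setT `<=` coefs_in [set 0].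
    apply: lc_bracket_coefs_in => // x y _ _; apply: quad_br_coefs_in => // m n.
    by rewrite !G0 L0.
  by move=> /sub0 r0; apply: polyM_eqP => n; rewrite mcoef0; exact: r0.
(* [smallest] is an intersection of subspaces, each containing 0. *)
by move=> S [[S0 _] _].
Qed.
End QuadraticIdeals.

Theorem corollary3p3 (R : realType) (V : lmodType R[i]) (N : novikov V) :
  (forall k : R[i],
     lc_simple (quadratic_lca (gd_minus N k)) -> novikov_simple N) /\
  (lc_simple (novikov_lca N) -> novikov_simple N).
Proof.
split=> [k|]; apply: quadratic_lca_simple => I [I0 Ic _] a b Iab Iba //=.
(* The trivial bracket lies in [I] by [I0]. For the other, the commutator is written [c *: u + v]
   with [c = -1], the form that [Ic] takes. *)
rewrite /minus_bracket addrC -scaleN1r.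
by apply: (submod_setZ (conj I0 Ic)); exact: Ic.
Qed.
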